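(* Let $(X,S)$ be an association scheme, $T$ a closed subset of $S$, and $X_1, X_2, \dots, X_m$ the cosets of $T$ in $X$. Suppose that $\iota_1, \iota_2, \dots, \iota_m \in \mathrm{Aut}(T)$ extend to $\tilde{\iota}_1, \tilde{\iota}_2, \dots, \tilde{\iota}_m \in \mathrm{Aut}(S)$ by $s^{\tilde{\iota}_j} = s$ if $s \in S \setminus T$ and $s^{\tilde{\iota}_j}= s^{\iota_j}$ if $s \in T$, for all $j=1, \dots, m$ (that is, each map $\tilde{\iota}_j : S \to S$ so defined belongs to $\mathrm{Aut}(S)$). Let $S' = \{s' \mid s \in S \}$, where $s'=s$ if $s \in S \setminus T$ and $s' = \bigcup_{j=1}^m (s^{\iota_j} \cap (X_j \times X_j))$ if $s \in T$. Then $(X,S')$ is an association scheme which is algebraically isomorphic to $(X,S)$.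
   Context: An association scheme $(X,S)$ consists of a non-empty finite set $X$ and a partition $S$ of $X\times X$ such that: (i) $1_X:=\{(x,x)\mid x\in X\}\in S$; (ii) for each $s\in S$, $s^*:=\{(x,y)\mid (y,x)\in s\}\in S$; (iii) for all $s,t,u\in S$ the number $c_{st}^u:=|xs\cap yt^*|$ is constant whenever $(x,y)\in u$, where $xs:=\{y\in X\mid (x,y)\in s\}$. The $c_{st}^u$ are the intersection numbers. For non-empty $P,Q\subseteq S$, the complex product $PQ$ is the set of all $s\in S$ such that $c_{pq}^s\neq 0$ for some $p\in P$, $q\in Q$. A non-empty subset $T\subseteq S$ is closed if $TT\subseteq T$ (equivalently, $\bigcup_{t\in T}t$ is an equivalence relation on $X$). For closed $T$, the cosets of $T$ in $X$ are the sets $xT:=\bigcup_{t\in T}xt$, $x\in X$. For a closed subset $T$ of $S$ (including $T=S$), $\mathrm{Aut}(T)=\{\iota\in\mathrm{Sym}(T)\mid c_{rs}^t=c_{r^\iota s^\iota}^{t^\iota}\text{ for all }r,s,t\in T\}$. Two association schemes $(X,S)$ and $(X_1,S_1)$ are algebraically isomorphic if there is a bijection $\iota:S\to S_1$ with $c_{rs}^t=c_{r^\iota s^\iota}^{t^\iota}$ for all $r,s,t\in S$. *)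

(* Defs.v *)
From mathcomp Require Import all_boot all_fingroup.

Set Implicit Arguments.
Unset Strict Implicit.
Unset Printing Implicit Defensive.

Section Scheme.
Variable X : finType.
Implicit Types (s t u : {set X * X}) (S T P Q : {set {set X * X}}).

Definition diagonal : {set X * X} := [set p | p.1 == p.2].

Definition converse s : {set X * X} := [set p | (p.2, p.1) \in s].

Definition neighbours (x : X) s : {set X} := [set y | (x, y) \in s].

Definition path_count s t (x y : X) : nat :=
  #|neighbours x s :&: neighbours y (converse t)|.

Definition association_scheme S : Prop :=
  [/\ 0 < #|X|,
      partition S [set: X * X],
      diagonal \in S,
      {in S, forall s, converse s \in S}
    & {in S & &, forall s t u, exists c : nat,
        forall x y : X, (x, y) \in u -> path_count s t x y = c}].

(* [inum s t u] is c_{st}^u, computed at an arbitrary pair of u; in an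
   association scheme u is nonempty and the value does not depend on the pair.
   The default 0 is only used for the empty relation. *)
Definition inum s t u : nat :=
  if [pick p in u] is Some p then path_count s t p.1 p.2 else 0.

Definition complex_product S P Q : {set {set X * X}} :=
  [set s in S | [exists p in P, exists q in Q, inum p q s != 0]].

Definition closed_subset S T : Prop :=
  [/\ T \subset S, T != set0 & complex_product S T T \subset T].

Definition scheme_coset (x : X) T : {set X} := \bigcup_(t in T) neighbours x t.

Definition scheme_cosets T : {set {set X}} := [set scheme_coset x T | x : X].

(* An element of Sym(T) is represented by the permutation of all binary
   relations on X that extends it by the identity outside T. *)
Definition scheme_aut T : {set {perm {set X * X}}} :=
  [set i in Sym T | [forall r in T, forall s in T, forall t in T,
                       inum r s t == inum (i r) (i s) (i t)]].

Definition switched T (m : nat) (Xc : 'I_m -> {set X})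
    (iota : 'I_m -> {perm {set X * X}}) s : {set X * X} :=
  if s \in T then \bigcup_(j < m) (iota j s :&: setX (Xc j) (Xc j)) else s.

End Scheme.

Definition algebraically_isomorphic (X X1 : finType)
    (S : {set {set X * X}}) (S1 : {set {set X1 * X1}}) : Prop :=
  exists f : {set X * X} -> {set X1 * X1},
    [/\ {in S &, injective f},
        f @: S = S1
      & {in S & &, forall r s t, inum r s t = inum (f r) (f s) (f t)}].

(* Main.v *)
Require Import Defs.
From mathcomp Require Import all_boot all_fingroup.

Set Implicit Arguments.
Unset Strict Implicit.
Unset Printing Implicit Defensive.

(** Write [sigma_i] for the extension of [iota_i] to [S] and [i(x)] for the index
    of the coset of [x].  Since an edge [(x, y)] of a relation of [T] stays inside
    one coset, [(x, y)] lies in [s'] iff it lies in [sigma_i(x) s], and also iff it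
    lies in [sigma_i(y) s].  Hence the paths of type [r', s'] from [x] to [y] are
    those of type [sigma_i(x) r, sigma_i(y) s].  One of the two indices can be
    replaced by the other, since they agree if [x] and [y] share a coset, and
    the automorphisms fix [S \ T]; the only exception is [r, s] in [T] with [x], [y]
    in different cosets, where there are no paths at all because [T] is closed.
    So the automorphism property gives the same intersection numbers for [S']. *)

Section Schemes.
Variables (X : finType) (S : {set {set X * X}}).
Hypothesis hS : association_scheme S.
Implicit Types (s t u : {set X * X}) (x y z : X) (f : {perm {set X * X}}).

(** * Paths and relations of a scheme *)

Lemma path_countE s t x y :
  path_count s t x y = #|[set z | ((x, z) \in s) && ((z, y) \in t)]|.
Proof. by apply: eq_card => z; rewrite !inE. Qed.

Lemma path_countP s t x y :
  reflect (exists2 z, (x, z) \in s & (z, y) \in t) (path_count s t x y != 0).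
Proof.
rewrite path_countE cards_eq0; apply: (iffP (set0Pn _)).
  by case=> z; rewrite inE => /andP[xz zy]; exists z.
by case=> z xz zy; exists z; rewrite inE xz.
Qed.

Lemma scheme_neq0 s : s \in S -> exists x y, (x, y) \in s.
Proof.
case: hS => _ /and3P[_ _ S0] _ _ _ sS.
suff /set0Pn[[x y] xy] : s != set0 by exists x, y.
by apply: contraNneq S0 => <-.
Qed.

Lemma scheme_block x y : exists2 s, s \in S & (x, y) \in s.
Proof.
case: hS => _ /and3P[/eqP covS _ _] _ _ _.
by have := in_setT (x, y); rewrite -covS => /bigcupP[s sS xy]; exists s.
Qed.

Lemma scheme_block_inj s t x y :
  s \in S -> t \in S -> (x, y) \in s -> (x, y) \in t -> s = t.
Proof.
case: hS => _ /and3P[_ tiS _] _ _ _ sS tS xs xt.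
by rewrite -(def_pblock tiS sS xs) (def_pblock tiS tS xt).
Qed.

Lemma diag_in : diagonal X \in S. Proof. by case: hS. Qed.

Lemma converse_in s : s \in S -> converse s \in S.
Proof. by case: hS => _ _ _ h _; apply: h. Qed.

Lemma in_diagonal x y : ((x, y) \in diagonal X) = (x == y).
Proof. by rewrite inE. Qed.

Lemma in_converse s x y : ((x, y) \in converse s) = ((y, x) \in s).
Proof. by rewrite inE. Qed.

Lemma inumE s t u x y : s \in S -> t \in S -> u \in S -> (x, y) \in u ->
  inum s t u = path_count s t x y.
Proof.
case: hS => _ _ _ _ h sS tS uS xy; have [c cP] := h s t u sS tS uS.
rewrite /inum; case: pickP => [[a b] /= ab|/(_ (x, y))]; last by rewrite xy.
by rewrite !cP.
Qed.

(** Both sides are the valency of [s], the intersection number of [s] and its converse at the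
    diagonal. *)
Lemma neighbours_card s x y : s \in S -> #|neighbours x s| = #|neighbours y s|.
Proof.
move=> sS.
have nE z : #|neighbours z s| = inum s (converse s) (diagonal X).
  rewrite (@inumE _ _ _ z z) ?converse_in ?diag_in ?in_diagonal // path_countE.
  by apply: eq_card => w; rewrite !inE andbb.
by rewrite !nE.
Qed.

Lemma neighbours_neq0 s x : s \in S -> exists y, (x, y) \in s.
Proof.
move=> sS; have [a [b ab]] := scheme_neq0 sS.
have /set0Pn[y] : neighbours x s != set0.
  rewrite -card_gt0 (neighbours_card _ a) // card_gt0.
  by apply/set0Pn; exists b; rewrite inE.
by rewrite inE => xy; exists y.
Qed.

(** This and the next two lemmas describe the diagonal and the converse by nonvanishing intersection
    numbers, which automorphisms preserve. *)
Lemma inum_diagl_neq0 s t : s \in S -> t \in S ->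
  (inum (diagonal X) s t != 0) = (s == t).
Proof.
move=> sS tS; have [x [y xy]] := scheme_neq0 tS.
rewrite (inumE _ _ _ xy) ?diag_in //.
apply/path_countP/eqP => [[z]|->].
  by rewrite in_diagonal => /eqP<- xys; apply: scheme_block_inj xys xy.
by exists x; rewrite ?in_diagonal.
Qed.

Lemma inum_diagr_neq0 s t : s \in S -> t \in S ->
  (inum s (diagonal X) t != 0) = (s == t).
Proof.
move=> sS tS; have [x [y xy]] := scheme_neq0 tS.
rewrite (inumE _ _ _ xy) ?diag_in //.
apply/path_countP/eqP => [[z]|->].
  by rewrite in_diagonal => xz /eqP zy; rewrite zy in xz; apply: scheme_block_inj xz xy.
by exists y; rewrite ?in_diagonal.
Qed.

Lemma inum_to_diag_neq0 s t : s \in S -> t \in S ->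
  (inum s t (diagonal X) != 0) = (t == converse s).
Proof.
move=> sS tS; have [x [y xy]] := scheme_neq0 sS.
rewrite (@inumE _ _ _ x x) ?diag_in ?in_diagonal //.
apply/path_countP/eqP => [[z xz zx]|->]; last by exists y; rewrite ?in_converse.
by apply: (@scheme_block_inj _ _ z x) => //; rewrite ?converse_in ?in_converse.
Qed.

(** * Automorphisms of a scheme *)

Lemma scheme_aut_closed f s : f \in scheme_aut S -> (f s \in S) = (s \in S).
Proof. by rewrite !inE => /andP[fS _]; apply: perm_closed. Qed.

Lemma scheme_aut_inum f r s t : f \in scheme_aut S ->
  r \in S -> s \in S -> t \in S -> inum (f r) (f s) (f t) = inum r s t.
Proof.
rewrite inE => /andP[_ /forallP fP] rS sS tS.
have /implyP/(_ rS)/forallP/(_ s)/implyP/(_ sS)/forallP/(_ t) := fP r.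
by move=> /implyP/(_ tS)/eqP.
Qed.

Lemma scheme_aut_diag f : f \in scheme_aut S -> f (diagonal X) = diagonal X.
Proof.
move=> fA; apply/eqP; have dS := diag_in.
(* With $g = f^{-1}(1_X)$, the nonzero number $c_{1g}^g$ is carried by [f] to $c_{f(1)1}^1$, which
   forces $f(1) = 1$. *)
have gS : f^-1%g (diagonal X) \in S by rewrite -(scheme_aut_closed _ fA) permKV.
rewrite -inum_diagr_neq0 ?scheme_aut_closed //.
have := scheme_aut_inum fA dS gS gS; rewrite permKV => ->.
by rewrite inum_diagl_neq0.
Qed.

Lemma scheme_aut_converse f s : f \in scheme_aut S -> s \in S ->
  f (converse s) = converse (f s).
Proof.
move=> fA sS; apply/eqP; have csS := converse_in sS.
rewrite -inum_to_diag_neq0 ?scheme_aut_closed // -{1}(scheme_aut_diag fA).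
by rewrite scheme_aut_inum ?diag_in // inum_to_diag_neq0.
Qed.

(** * Closed subsets and their cosets *)

Variable T : {set {set X * X}}.
Hypothesis hT : closed_subset S T.

Lemma closed_in s : s \in T -> s \in S.
Proof. by case: hT => /subsetP TS _ _; apply: TS. Qed.

Lemma cover_trans x y z :
  (x, y) \in cover T -> (y, z) \in cover T -> (x, z) \in cover T.
Proof.
case: hT => _ _ /subsetP TT /bigcupP[s sT xy] /bigcupP[t tT yz].
have [u uS xz] := scheme_block x z; apply/bigcupP; exists u => //.
apply: TT; rewrite inE uS; apply/existsP; exists s; rewrite sT.
apply/existsP; exists t; rewrite tT (inumE _ _ uS xz) ?closed_in //.
by apply/path_countP; exists y.
Qed.

Lemma mem_scheme_coset x y : (y \in scheme_coset x T) = ((x, y) \in cover T).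
Proof.
apply/bigcupP/bigcupP => -[s sT xy]; exists s => //; first by rewrite inE in xy.
by rewrite inE.
Qed.

(** A coset is the disjoint union of the neighbourhoods for the relations in [T], so its size is a
    sum of valencies. *)
Lemma scheme_coset_card x y : #|scheme_coset x T| = #|scheme_coset y T|.
Proof.
have cE z : #|scheme_coset z T| = \sum_(s in T) #|neighbours z s|.
  rewrite -sum1_card (eq_bigr (fun s => \sum_(w in neighbours z s) 1)); last first.
    by move=> s _; rewrite sum1_card.
  rewrite (exchange_big_dep (mem (scheme_coset z T))) /=; last first.
    by move=> s w sT zw; apply/bigcupP; exists s.
  apply: eq_bigr => w /bigcupP[s sT zw]; rewrite (big_pred1 s) // => t /=.
  apply/andP/eqP => [[tT zt]|->//].
  by rewrite !inE in zw zt; apply: scheme_block_inj zt zw; apply: closed_in.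
by rewrite !cE; apply: eq_bigr => s sT; apply: neighbours_card; apply: closed_in.
Qed.

(* By transitivity [yT] is contained in [xT]; both have the same size. *)
Lemma scheme_coset_eq x y :
  (x, y) \in cover T -> scheme_coset y T = scheme_coset x T.
Proof.
move=> xy; apply/eqP; rewrite eqEcard (scheme_coset_card x y) leqnn andbT.
by apply/subsetP => z; rewrite !mem_scheme_coset; apply: cover_trans.
Qed.

(** For an edge $(a,b)$ of [T], the point $b$ lies in $aT = bT$. So some relation of [T] contains
    $(b,b)$; it must be the diagonal. *)
Lemma cover_refl x : (x, x) \in cover T.
Proof.
case: hT => _ /set0Pn[s sT] _.
have [a [b ab]] := scheme_neq0 (closed_in sT).
have abT : (a, b) \in cover T by apply/bigcupP; exists s.
have : (b, b) \in cover T.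
  by rewrite -mem_scheme_coset (scheme_coset_eq abT) mem_scheme_coset.
case/bigcupP=> t tT bb; apply/bigcupP; exists t => //.
suff -> : t = diagonal X by rewrite in_diagonal.
by apply: (scheme_block_inj (closed_in tT) diag_in bb); rewrite in_diagonal.
Qed.

Lemma cover_coset x y :
  ((x, y) \in cover T) = (scheme_coset x T == scheme_coset y T).
Proof.
apply/idP/eqP => [/scheme_coset_eq->//|xyE].
by rewrite -mem_scheme_coset xyE mem_scheme_coset cover_refl.
Qed.

Lemma mem_cover_block s x y : s \in S -> (x, y) \in s ->
  ((x, y) \in cover T) = (s \in T).
Proof.
move=> sS xy; apply/bigcupP/idP => [[t tT xyt]|sT]; last by exists s.
by rewrite (scheme_block_inj sS (closed_in tT) xy xyt).
Qed.

(** * Indexing the cosets *)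

Variables (m : nat) (Xc : 'I_m -> {set X}).
Hypotheses (hXc_inj : injective Xc)
  (hXc : [set Xc j | j : 'I_m] = scheme_cosets T).

(** Stated as a sigma type so that the index can be extracted as a function of the point. *)
Lemma coset_index x : {j | forall k, (x \in Xc k) = (k == j)}.
Proof.
have /imsetP/sig2_eqW[j _ xj] : scheme_coset x T \in [set Xc j | j : 'I_m].
  by rewrite hXc; apply: imset_f.
exists j => k; rewrite -(inj_eq hXc_inj) -xj.
have /imsetP[w _ ->] : Xc k \in scheme_cosets T by rewrite -hXc imset_f.
by rewrite mem_scheme_coset cover_coset.
Qed.

Definition cidx x : 'I_m := sval (coset_index x).

Lemma mem_Xc x j : (x \in Xc j) = (j == cidx x).
Proof. by rewrite /cidx; case: coset_index. Qed.

Lemma cover_cidx x y : ((x, y) \in cover T) = (cidx x == cidx y).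
Proof.
have /imsetP[w _ xw] : Xc (cidx x) \in scheme_cosets T by rewrite -hXc imset_f.
have : x \in Xc (cidx x) by rewrite mem_Xc.
by rewrite -mem_Xc xw !mem_scheme_coset !cover_coset => /eqP->.
Qed.

(** * Switched relations and their path counts *)

Variables iota tiota : 'I_m -> {perm {set X * X}}.
Hypotheses (hiota : forall j, iota j \in scheme_aut T)
  (htiota : forall j, tiota j \in scheme_aut S)
  (htiota_out : forall j, {in S :\: T, forall s, tiota j s = s})
  (htiota_in : forall j, {in T, forall s, tiota j s = iota j s}).
Local Notation sw := (switched T Xc iota).

Lemma tiota_in j s : (tiota j s \in S) = (s \in S).
Proof. exact: scheme_aut_closed. Qed.

Lemma tiota_inT j s : s \in S -> (tiota j s \in T) = (s \in T).
Proof.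
move=> sS; have [sT|sNT] := boolP (s \in T).
  rewrite htiota_in //; have := hiota j; rewrite inE => /andP[iT _].
  by rewrite inE in iT; rewrite (perm_closed _ iT).
by rewrite htiota_out ?inE ?sNT // (negPf sNT).
Qed.

Lemma tiota_indep j k s : s \in S -> s \notin T -> tiota j s = tiota k s.
Proof. by move=> sS sNT; rewrite !htiota_out ?inE ?sNT. Qed.

Lemma mem_switched s x y : s \in S ->
  ((x, y) \in sw s) = ((x, y) \in tiota (cidx x) s).
Proof.
move=> sS; rewrite /switched; case: ifP => [sT|sNT]; last first.
  by rewrite htiota_out // inE sNT.
apply/bigcupP/idP => [[j _]|xy].
  by rewrite !inE /= mem_Xc => /and3P[xy /eqP<- _]; rewrite htiota_in.
(* The image of [s] is again in [T], so its edge $(x,y)$ has both ends in the coset of $x$. *)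
exists (cidx x) => //; rewrite !inE /= !mem_Xc eqxx -cover_cidx.
rewrite (mem_cover_block _ xy) ?tiota_in // tiota_inT // sT.
by rewrite -htiota_in ?xy.
Qed.

(** For [s] in [T], an edge on either side lies in a relation of [T], so the two indices agree;
    otherwise both images are [s]. *)
Lemma tiota_cidx s x y : s \in S ->
  ((x, y) \in tiota (cidx x) s) = ((x, y) \in tiota (cidx y) s).
Proof.
move=> sS; have [sT|sNT] := boolP (s \in T); last first.
  by rewrite (tiota_indep _ (cidx y)).
by apply/idP/idP => xy; have := xy; suff /eqP-> : cidx x == cidx y by [];
  rewrite -cover_cidx (mem_cover_block _ xy) ?tiota_in ?tiota_inT.
Qed.

Lemma path_count_switched r s u x y : r \in S -> s \in S -> u \in S ->
  (x, y) \in sw u -> path_count (sw r) (sw s) x y = inum r s u.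
Proof.
move=> rS sS uS; rewrite mem_switched // => xyi.
have xyj : (x, y) \in tiota (cidx y) u by rewrite -tiota_cidx.
(* Reading the first edge at its start and the second at its end makes both relations independent of
   the middle point $z$. *)
have -> : path_count (sw r) (sw s) x y =
    path_count (tiota (cidx x) r) (tiota (cidx y) s) x y.
  rewrite !path_countE; apply: eq_card => z.
  by rewrite !inE !mem_switched // (tiota_cidx z y).
have [sT|sNT] := boolP (s \in T); last first.
  rewrite (tiota_indep (cidx y) (cidx x)) //.
  by rewrite -(@inumE _ _ (tiota (cidx x) u)) ?tiota_in // scheme_aut_inum.
have [rT|rNT] := boolP (r \in T); last first.
  rewrite (tiota_indep (cidx x) (cidx y)) //.
  by rewrite -(@inumE _ _ (tiota (cidx y) u)) ?tiota_in // scheme_aut_inum.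
have [ij|ij] := eqVneq (cidx x) (cidx y).
  by rewrite -ij -(@inumE _ _ (tiota (cidx x) u)) ?tiota_in // scheme_aut_inum.
have no_path p q : p \in T -> q \in T -> path_count p q x y = 0.
  move=> pT qT; apply/eqP; apply: contraNT ij => /path_countP[z xz zy].
  by rewrite -cover_cidx; apply: (@cover_trans _ z);
    apply/bigcupP; [exists p | exists q].
rewrite no_path ?tiota_inT //.
(* The right side vanishes too: transported by the automorphism at $x$, it counts paths from $x$ to
   $y$ within [T]. *)
rewrite -(scheme_aut_inum (htiota (cidx x)) rS sS uS).
by rewrite (inumE _ _ _ xyi) ?tiota_in // no_path ?tiota_inT.
Qed.

(** * Scheme axioms for the switched relations *)

Lemma switched_neighbours_neq0 s x : s \in S -> exists y, (x, y) \in sw s.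
Proof.
move=> sS; have [|y xy] := @neighbours_neq0 (tiota (cidx x) s) x.
  by rewrite tiota_in.
by exists y; rewrite mem_switched.
Qed.

(** At a fixed start $x$, all switched relations are read through the same permutation of [S]. *)
Lemma switched_block_inj r s x y : r \in S -> s \in S ->
  (x, y) \in sw r -> (x, y) \in sw s -> r = s.
Proof.
move=> rS sS; rewrite !mem_switched // => xr xs.
by apply: (@perm_inj _ (tiota (cidx x))); apply: scheme_block_inj xr xs;
  rewrite tiota_in.
Qed.

Lemma switched_neq0 s : s \in S -> exists x y, (x, y) \in sw s.
Proof.
case: (hS) => /card_gt0P[x _] _ _ _ _ sS.
by exists x; apply: switched_neighbours_neq0.
Qed.

Lemma switched_inj : {in S &, injective sw}.
Proof.
move=> r s rS sS rsE; have [x [y xy]] := switched_neq0 rS.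
by apply: (switched_block_inj rS sS xy); rewrite -rsE.
Qed.

Lemma switched_diagonal : sw (diagonal X) = diagonal X.
Proof.
by apply/setP => -[x y]; rewrite mem_switched ?diag_in // scheme_aut_diag.
Qed.

Lemma switched_converse s : s \in S -> converse (sw s) = sw (converse s).
Proof.
move=> sS; apply/setP => -[x y].
rewrite in_converse !mem_switched ?converse_in // tiota_cidx //.
by rewrite scheme_aut_converse // in_converse.
Qed.

Lemma switched_partition : partition [set sw s | s in S] [set: X * X].
Proof.
apply/and3P; split.
- apply/eqP/setP => -[x y]; rewrite inE; apply/bigcupP.
  have [t tS xy] := scheme_block x y.
  (* The relation to be switched is the preimage of [t] under the automorphism at $x$. *)
  pose s := (tiota (cidx x))^-1%g t.
  have sS : s \in S by rewrite -(tiota_in (cidx x)) permKV.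
  by exists (sw s); rewrite ?imset_f // mem_switched // permKV.
- apply/trivIsetP => _ _ /imsetP[r rS ->] /imsetP[s sS ->].
  apply: contraR => /pred0Pn[[x y] /andP[xr xs]].
  by rewrite (switched_block_inj rS sS xr xs).
- apply/imsetP => -[s sS s0]; have [x [y]] := switched_neq0 sS.
  by rewrite -s0 inE.
Qed.

Lemma switched_scheme : association_scheme [set sw s | s in S].
Proof.
split; first by case: hS.
- exact: switched_partition.
- by rewrite -switched_diagonal imset_f ?diag_in.
- move=> _ /imsetP[s sS ->].
  by rewrite switched_converse // imset_f ?converse_in.
- move=> _ _ _ /imsetP[r rS ->] /imsetP[s sS ->] /imsetP[u uS ->].
  by exists (inum r s u) => x y; apply: path_count_switched.
Qed.

Lemma inum_switched :
  {in S & &, forall r s u, inum r s u = inum (sw r) (sw s) (sw u)}.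
Proof.
move=> r s u rS sS uS; have [x [y xy]] := switched_neq0 uS.
(* Any picked pair gives the right count; the default 0 is excluded since [sw u] contains
   $(x,y)$. *)
rewrite [RHS]/inum; case: pickP => [[a b] ab|/(_ (x, y))]; last by rewrite xy.
by rewrite (path_count_switched rS sS uS ab).
Qed.

End Schemes.

Theorem theorem1p1 (X : finType) (S T : {set {set X * X}})
  (hS : association_scheme S) (hT : closed_subset S T)
  (m : nat) (Xc : 'I_m -> {set X})
  (hXc_inj : injective Xc) (hXc : [set Xc j | j : 'I_m] = scheme_cosets T)
  (iota tiota : 'I_m -> {perm {set X * X}})
  (hiota : forall j, iota j \in scheme_aut T)
  (htiota : forall j, tiota j \in scheme_aut S)
  (htiota_out : forall j, {in S :\: T, forall s, tiota j s = s})
  (htiota_in : forall j, {in T, forall s, tiota j s = iota j s}) :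
  let S' := [set switched T Xc iota s | s in S] in
  association_scheme S' /\ algebraically_isomorphic S S'.
Proof.
split; first exact: (switched_scheme hS hT hXc_inj hXc hiota htiota).
exists (switched T Xc iota); split=> //.
  exact: (switched_inj hS hT hXc_inj hXc hiota htiota).
exact: (inum_switched hS hT hXc_inj hXc hiota htiota).
Qed.
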